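(* Let $G$ be a connected graph admitting a local antimagic labeling, and let $f$ be a local antimagic labeling of $G$ inducing exactly $\chi_{la}(G)$ distinct vertex colors. Let $n\ge 3$. Suppose that for all $u,v\in V(G)$: (i) $f^+(u)=f^+(v)$ implies $\deg(u)=\deg(v)$; and (ii) $f^+(u)\ne f^+(v)$ implies $f^+(u)n^3-\frac{(n^3-n)\deg(u)}{2}\ne f^+(v)n^3-\frac{(n^3-n)\deg(v)}{2}$. Then $\chi(G[O_n])\le \chi_{la}(G[O_n])\le \chi_{la}(G)$. Moreover, $\chi_{la}(G[O_n])=\chi_{la}(G)$ holds if, in addition, (a) $\chi(G)=\chi_{la}(G)$, or (b) $G$ is bipartite with both partite sets of the same size and $\chi_{la}(G)=3$.
   Context: All graphs are finite and simple. For a graph $G=(V,E)$ with $q$ edges, a bijection $f:E\to\{1,\ldots,q\}$ is a local antimagic labeling if $f^+(u)\ne f^+(v)$ for all adjacent $u,v$, where $f^+(u)=\sum_{e\ni u} f(e)$ is the sum of labels of edges incident to $u$; it induces the proper vertex coloring $v\mapsto f^+(v)$. $\chi_{la}(G)$ is the minimum number of distinct values of $f^+$ over all local antimagic labelings of $G$. $\chi(G)$ is the chromatic number. $O_n$ denotes the null (edgeless) graph on $n$ vertices. For graphs $G,H$, the lexicographic product $G[H]$ has vertex set $V(G)\times V(H)$, with $(u,u')$ adjacent to $(v,v')$ iff $uv\in E(G)$, or $u=v$ and $u'v'\in E(H)$. Thus $G[O_n]$ replaces each vertex $u$ of $G$ by $n$ independent vertices and each edge $uv$ by a copy of $K_{n,n}$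 between the corresponding sets. *)

(* Defs.v *)
From HB Require Import structures.
From mathcomp Require Import all_boot all_order all_algebra.
Set Implicit Arguments.
Unset Strict Implicit.
Unset Printing Implicit Defensive.

Record sgraph := SGraph {
  vert :> finType;
  adj : rel vert;
  adj_sym : symmetric adj;
  adj_irr : irreflexive adj }.

Definition connected (G : sgraph) : bool :=
  (0 < #|{: G}|) && [forall u : G, forall v : G, connect (@adj G) u v].

Definition deg (G : sgraph) (u : G) : nat := #|[set v : G | adj u v]|.

Definition edges (G : sgraph) : {set {set G}} :=
  [set [set p.1; p.2] | p : G * G & adj p.1 p.2].

Definition edge (G : sgraph) : finType := {x : {set G} | x \in edges G}.

Definition nedges (G : sgraph) : nat := #|edges G|.

(* The codomain {0, ..., q} is cut down to {1, ..., q} by is_labeling. *)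
Definition edge_fun (G : sgraph) := {ffun edge G -> 'I_(nedges G).+1}.

Definition is_labeling (G : sgraph) (f : edge_fun G) : bool :=
  injectiveb f && (f @: [set: edge G] == [set k : 'I_(nedges G).+1 | 0 < k]).

Definition vsum (G : sgraph) (f : edge_fun G) (u : G) : nat :=
  \sum_(e : edge G | u \in val e) f e.

Definition local_antimagic (G : sgraph) (f : edge_fun G) : bool :=
  is_labeling f &&
  [forall u : G, forall v : G, adj u v ==> (vsum f u != vsum f v)].

Definition ncolors (G : sgraph) (f : edge_fun G) : nat :=
  size (undup [seq vsum f u | u : G]).

(* A labeling induces at most #|G| colors, so the value is #|G| + 1 exactly
   when G has no local antimagic labeling, and the minimum otherwise. *)
Definition chi_la (G : sgraph) : nat :=
  \big[minn/#|{: G}|.+1]_(f : edge_fun G | local_antimagic f) ncolors f.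

Definition colorable (G : sgraph) (k : nat) : bool :=
  [exists c : {ffun G -> 'I_k},
     [forall u : G, forall v : G, adj u v ==> (c u != c v)]].

(* Every graph is #|G|-colorable, so the default value is harmless. *)
Definition chi (G : sgraph) : nat :=
  \big[minn/#|{: G}|]_(k < #|{: G}|.+1 | colorable G k) (k : nat).

Definition balanced_bipartite (G : sgraph) : Prop :=
  exists A : {set G},
    (forall u v : G, adj u v -> (u \in A) != (v \in A)) /\ #|A| = #|~: A|.

Definition null_graph (n : nat) : sgraph :=
  @SGraph 'I_n (fun _ _ => false) (fun _ _ => erefl) (fun _ => erefl).

Section LexProduct.
Variables G H : sgraph.

Definition lex_adj : rel (G * H) := fun p q =>
  adj p.1 q.1 || (p.1 == q.1) && adj p.2 q.2.

Lemma lex_adj_sym : symmetric lex_adj.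
Proof.
by move=> p q; rewrite /lex_adj adj_sym [p.1 == _]eq_sym [adj p.2 _]adj_sym.
Qed.

Lemma lex_adj_irr : irreflexive lex_adj.
Proof. by move=> p; rewrite /lex_adj !adj_irr andbF. Qed.

Definition lex_product : sgraph := SGraph lex_adj_sym lex_adj_irr.
End LexProduct.

Import GRing.Theory.
Local Open Scope ring_scope.

(* Taken in rat: no truncated subtraction and exact division by 2. *)
Definition lifted_color (G : sgraph) (f : edge_fun G) (n : nat) (u : G) : rat :=
  (vsum f u)%:R * n%:R ^+ 3 - (n%:R ^+ 3 - n%:R) * (deg u)%:R / 2.

(* Main.v *)
Require Import Defs.
From mathcomp Require Import all_boot all_order all_algebra.
From mathcomp Require Import zify ring.
Set Implicit Arguments.
Unset Strict Implicit.
Unset Printing Implicit Defensive.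
Import GRing.Theory.

(* Let A be an n x n square with entries 0, ..., n^2 - 1 and constant row and
   column sums; it exists for every n >= 3.  Labeling the copy of K_{n,n} that
   replaces an edge e with (f e - 1) n^2 + A i j + 1 makes the sum at (u, i)
   equal to the lifted color of u, so G[O_n] gets at most as many colors as G.
   For the lower bound in the bipartite case, two colors would be constant on
   the two sides; both sides have the same total, namely the sum of all labels,
   and the same size, so the two colors would coincide. *)

(** * Semi-magic squares of every order at least 3 *)

(** Line sums are doubled to avoid the division in n(n^2 - 1)/2. The index type is arbitrary so that
    even orders can use signed indices. *)
Definition semi_magic (T : finType) (A : T -> T -> nat) : Prop :=
  [/\ forall i j, A i j < #|T| ^ 2,
      forall i j i' j', A i j = A i' j' -> i = i' /\ j = j',
      forall i, (\sum_j A i j).*2 = #|T| * (#|T| ^ 2).-1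
    & forall j, (\sum_i A i j).*2 = #|T| * (#|T| ^ 2).-1].

(** The entries are two-digit numbers in base [#|T|]: distinct digit pairs give distinct entries,
    and lines balanced in each digit are balanced in total. *)
Lemma semi_magic_digits (T : finType) (a b : T -> T -> nat) :
    (forall i j, a i j < #|T|) -> (forall i j, b i j < #|T|) ->
    (forall i j i' j', a i j = a i' j' -> b i j = b i' j' -> i = i' /\ j = j') ->
    (forall i, (\sum_j a i j).*2 = #|T| * #|T|.-1) ->
    (forall j, (\sum_i a i j).*2 = #|T| * #|T|.-1) ->
    (forall i, (\sum_j b i j).*2 = #|T| * #|T|.-1) ->
    (forall j, (\sum_i b i j).*2 = #|T| * #|T|.-1) ->
  semi_magic (fun i j => a i j * #|T| + b i j).
Proof.
move=> lta ltb inj ar ac br bc.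
have tot x y : x.*2 = #|T| * #|T|.-1 -> y.*2 = #|T| * #|T|.-1 ->
    (x * #|T| + y).*2 = #|T| * (#|T| ^ 2).-1.
  move=> hx hy; rewrite doubleD doubleMl hx hy.
  by case: #|T| => // k; rewrite -mulnn; nia.
split=> [i j|i j i' j' e|i|j].
- by have := lta i j; have := ltb i j; rewrite -mulnn; nia.
- have eb : b i j = b i' j'.
    by have := congr1 (modn^~ #|T|) e; rewrite !modnMDl !modn_small.
  apply: inj => //; apply/eqP; rewrite -(@eqn_pmul2r #|T|).
    by rewrite -(eqn_add2r (b i j)) {2}eb e.
  exact: leq_trans (ltb i j).
- by rewrite big_split -big_distrl; apply: tot.
- by rewrite big_split -big_distrl; apply: tot.
Qed.

Lemma sum_ord_double n : (\sum_(i < n) i).*2 = n * n.-1.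
Proof.
elim: n => [|n IHn]; first by rewrite big_ord0.
by rewrite big_ord_recr /= doubleD IHn; case: n {IHn} => //= n; nia.
Qed.

(** The digits i + j and i + 2j over Z/n are orthogonal Latin squares: doubling is injective for odd
    n, so every line of either digit is a permutation, and the difference of the digits recovers
    j. *)
Lemma semi_magic_odd n : odd n -> exists A : 'I_n -> 'I_n -> nat, semi_magic A.
Proof.
case: n => // n on.
pose a (i j : 'I_n.+1) : 'I_n.+1 := (i + j)%R.
pose b (i j : 'I_n.+1) : 'I_n.+1 := (i + j + j)%R.
have dbl_inj : injective (fun j : 'I_n.+1 => j + j)%R.
  move=> x y /(congr1 val) /= e; apply: val_inj => /=.
  wlog le_xy: x y e / x <= y.
    by case/orP: (leq_total x y) => le_xy wl; [|symmetry]; apply: wl.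
  move/esym/eqP: e; rewrite eqn_mod_dvd ?leq_add // !addnn -doubleB -mul2n.
  rewrite Gauss_dvdr ?coprimen2 // => /dvdn_leq; have := ltn_ord y; lia.
have sum_inj (h : 'I_n.+1 -> 'I_n.+1) : injective h ->
    (\sum_j (h j : nat)).*2 = #|'I_n.+1| * #|'I_n.+1|.-1.
  move=> hinj; rewrite card_ord -sum_ord_double.
  by rewrite [in RHS](reindex h) //; apply: onW_bij; apply: injF_bij.
exists (fun i j => a i j * #|'I_n.+1| + b i j).
apply: semi_magic_digits => [i j|i j|i j i' j'|i|j|i|j]; rewrite ?card_ord //.
- move=> /val_inj ea /val_inj; rewrite /b -/(a i j) -/(a i' j') ea.
  by move/addrI=> ej; move: ea; rewrite /a ej => /addIr.
- by have := sum_inj (a i) (addrI i); rewrite card_ord.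
- by have := sum_inj (a^~ j) (addIr j); rewrite card_ord.
- have := sum_inj (b i); rewrite card_ord; apply.
  by move=> x y; rewrite /b -!addrA => /addrI /dbl_inj.
- have := sum_inj (b^~ j); rewrite card_ord; apply.
  by move=> x y; rewrite /b => /addIr /addIr.
Qed.

(* Rows and columns of the square of order 2M are indexed by bool * 'I_M, with
   (s, i) standing for fold_val (s, i), so that (~~ s, i) is the mirror image of
   (s, i).  In the natural square the mirror images permute the four cells with
   given i and j.  Reflecting cells vertically does not change column sums, and
   it balances row i when half of its cells are reflected; likewise for
   horizontal reflections.  For odd M a line meets an odd number of four-cell
   blocks, so in one block per line (d = 0 in flip) only one cell of the mirror
   pair is reflected.  The offset by 1 in semi_magic_even keeps these special
   blocks apart for the two directions, which preserves injectivity. *)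
Section EvenOrder.
Variable m : nat.
Notation M := m.+2.

Definition fold_val (x : bool * 'I_M) : nat :=
  if x.1 then M.*2.-1 - x.2 else x.2.

Definition flip (d : 'I_M) (t : bool) : bool :=
  odd d || [&& odd M, d == 0%R & t].

Lemma fold_val_lt x : fold_val x < M.*2.
Proof. by case: x => [[] i]; rewrite /fold_val /=; have := ltn_ord i; lia. Qed.

Lemma fold_val_inj : injective fold_val.
Proof.
move=> [s i] [t j]; have := ltn_ord i; have := ltn_ord j.
rewrite /fold_val /=; case: s; case: t => /= lti ltj e;
  [ | lia | lia | ]; congr pair; apply: val_inj => /=; lia.
Qed.

Lemma fold_val_compl s i : fold_val (s, i) + fold_val (~~ s, i) = M.*2.-1.
Proof. by have := ltn_ord i; rewrite /fold_val; case: s => /=; lia. Qed.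

Lemma sum_alternating x y k :
  \sum_(d < k.*2) (if odd d then x else y) = k * (x + y).
Proof.
elim: k => [|k IHk]; first by rewrite big_ord0.
by rewrite doubleS !big_ord_recr /= IHk odd_double /=; lia.
Qed.

(** Let w and w' be the value of (s, i) and of its mirror image. Offset d contributes 2w' if odd, 2w
    if even, and w + w' if d = 0 with M odd, so w and w' occur M times each. *)
Lemma sum_flip_line s i c :
  \sum_(x : bool * 'I_M) fold_val (s (+) flip (x.2 - c)%R x.1, i) = M * M.*2.-1.
Proof.
rewrite -(fold_val_compl s i).
rewrite -(pair_bigA _ (fun t j => fold_val (s (+) flip (j - c)%R t, i))) /=.
rewrite exchange_big /= (reindex (fun d : 'I_M => d + c)%R) /=; last first.
  by apply: onW_bij; apply: injF_bij; apply: addIr.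
set w := fold_val (s, i); set w' := fold_val (~~ s, i).
have wE b : fold_val (s (+) b, i) = if b then w' else w.
  by rewrite /w /w'; case: b; rewrite ?addbT ?addbF.
transitivity (\sum_(d < M) (if odd d then w'.*2 else
                 if odd M && (d == 0 :> nat) then w + w' else w.*2)).
  apply: eq_bigr => d _; rewrite big_bool /= addrK !wE /flip.
  rewrite -[(d == 0)%R]/(d == 0 :> nat); case: (odd d) => /=; first by rewrite addnn.
  by rewrite andbT !andbF; case: ifP => _; [rewrite addnC | rewrite addnn].
case oM: (odd M).
  have: M = (M./2).*2.+1 by have := odd_double_half M; rewrite oM; lia.
  move: (M./2) => k ->; rewrite big_ord_recl /=.
  (* Removing d = 0 shifts the offsets by one, so the parities trade roles. *)
  rewrite (eq_bigr (fun d : 'I_k.*2 => if odd d then w.*2 else w'.*2)).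
    by rewrite sum_alternating; lia.
  by move=> d _; rewrite /bump /=; case: odd.
have: M = (M./2).*2 by have := odd_double_half M; rewrite oM; lia.
move: (M./2) => k ->; have := sum_alternating w'.*2 w.*2 k => /= ->; lia.
Qed.

(** The reflection does not depend on the sign, so it only swaps two mirror images, whose sum is 2M
    - 1. *)
Lemma sum_flip_cross (g : 'I_M -> bool) :
  \sum_(x : bool * 'I_M) fold_val (x.1 (+) g x.2, x.2) = M * M.*2.-1.
Proof.
rewrite -(pair_bigA _ (fun s i => fold_val (s (+) g i, i))) /= exchange_big /=.
under eq_bigr => i _.
  rewrite big_bool /= addnC fold_val_compl.
over.
by rewrite sum_nat_const card_ord.
Qed.

Lemma semi_magic_even : exists A : bool * 'I_M -> bool * 'I_M -> nat, semi_magic A.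
Proof.
pose a (x y : bool * 'I_M) := fold_val (x.1 (+) flip (y.2 - x.2)%R y.1, x.2).
pose b (x y : bool * 'I_M) := fold_val (y.1 (+) flip (x.2 - (y.2 + 1))%R x.1, y.2).
have cT : #|{: bool * 'I_M}| = M.*2 by rewrite card_prod card_bool card_ord mul2n.
have sumE x : x = M * M.*2.-1 -> x.*2 = #|{: bool * 'I_M}| * #|{: bool * 'I_M}|.-1.
  by rewrite cT => ->; rewrite doubleMl.
exists (fun x y => a x y * #|{: bool * 'I_M}| + b x y).
apply: semi_magic_digits => [x y|x y| |x|y|x|y]; rewrite ?cT ?fold_val_lt //.
- move=> [s i] [t j] [s' i'] [t' j'] /fold_val_inj /= [ea ei] /fold_val_inj [eb ej].
  move: ea eb; rewrite {}ei {}ej /flip.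
  (* [flip] reads its Boolean only at offset 0. If j = i, the other offset is -1, nonzero as M >= 2,
     so t is recovered first and then s; otherwise s comes first. *)
  have [dij | _] := eqVneq (j' - i')%R 0%R.
    have -> : (i' - (j' + 1) == 0)%R = false.
      by rewrite opprD addrA -[(i' - j')%R]opprB dij oppr0 add0r oppr_eq0 oner_eq0.
    by rewrite !andbF => ea eb; move: ea; rewrite (addIb eb) => ea; rewrite (addIb ea).
  rewrite !andFb !andbF => ea; rewrite (addIb ea) => eb; by rewrite (addIb eb).
- by rewrite -cT; apply/sumE/sum_flip_line.
- rewrite -cT; apply: sumE; exact: (sum_flip_cross (fun i => flip (y.2 - i)%R y.1)).
- rewrite -cT; apply: sumE.
  exact: (sum_flip_cross (fun j => flip (x.2 - (j + 1))%R x.1)).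
- by rewrite -cT; apply/sumE/sum_flip_line.
Qed.
End EvenOrder.

Lemma semi_magic_bij (T T' : finType) (h : T' -> T) (A : T -> T -> nat) :
  bijective h -> semi_magic A -> semi_magic (fun i j => A (h i) (h j)).
Proof.
move=> hbij [ltA injA rowA colA]; have cT := bij_eq_card hbij.
split=> [i j|i j i' j' /injA [] |i|j]; rewrite ?cT //.
- by move=> /(bij_inj hbij) -> /(bij_inj hbij) ->.
- by rewrite -(rowA (h i)) [in RHS](reindex h) //; apply: onW_bij.
- by rewrite -(colA (h j)) [in RHS](reindex h) //; apply: onW_bij.
Qed.

Lemma semi_magic_exists n : 3 <= n -> exists A : 'I_n -> 'I_n -> nat, semi_magic A.
Proof.
move=> n3; case on: (odd n); first exact: semi_magic_odd.
(* An even n >= 3 is at least 4, so the truncated subtraction is exact and M = n/2. *)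
have [A smA] := semi_magic_even (n./2 - 2).
have cT : #|{: bool * 'I_(n./2 - 2).+2}| = n.
  by rewrite card_prod card_bool card_ord; have := odd_double_half n; lia.
exists (fun i j => A (enum_val (cast_ord (esym cT) i))
                     (enum_val (cast_ord (esym cT) j))).
apply: semi_magic_bij smA.
by apply: bij_comp; [exact: enum_val_bij | exists (cast_ord cT) => x; apply: val_inj].
Qed.

(** * Edge labelings as symmetric functions of two vertices *)

Lemma set2_inj (T : finType) (a b c d : T) : a != b ->
  [set a; b] = [set c; d] -> (a = c /\ b = d) \/ (a = d /\ b = c).
Proof.
move=> nab e; have: a \in [set c; d] by rewrite -e set21.
have: b \in [set c; d] by rewrite -e set22.
by move: nab => /[swap] /set2P [] -> /[swap] /set2P [] ->; rewrite ?eqxx; auto.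
Qed.

Section Edges.
Variable G : sgraph.
Implicit Types (u v : G) (f : edge_fun G).

Lemma adj_neq u v : adj u v -> u != v.
Proof. by apply: contraTneq => ->; rewrite adj_irr. Qed.

Lemma mem_edges u v : ([set u; v] \in edges G) = adj u v.
Proof.
apply/imsetP/idP => [[[a b]]|auv]; last by exists (u, v); rewrite ?inE.
rewrite inE /= => ab /esym /(set2_inj (adj_neq ab)) [] [<- <-] //.
by rewrite adj_sym.
Qed.

Lemma edgesP (e : {set G}) :
  reflect (exists u v, adj u v /\ e = [set u; v]) (e \in edges G).
Proof.
apply: (iffP imsetP) => [[[u v]]|[u [v [auv ->]]]]; last by exists (u, v); rewrite ?inE.
by rewrite inE /= => auv ->; exists u, v.
Qed.

Lemma sum_incident (F : {set G} -> nat) u :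
  \sum_(e : edge G | u \in val e) F (val e) = \sum_(v | adj u v) F [set u; v].
Proof.
rewrite -(big_sub_cond (mem (edges G)) (fun e => u \in e) F) /=.
(* The inverse of v |-> {u, v} returns the other end; its default u is never reached on an edge at
   u. *)
rewrite (reindex_onto (fun v => [set u; v]) (fun e => odflt u [pick v | e == [set u; v]])) /=.
  apply: eq_bigl => v; rewrite mem_edges set21 andbT.
  case: pickP => [w /eqP|/(_ v)]; last by rewrite eqxx.
  case: (boolP (adj u v)) => //= /adj_neq nuv /(set2_inj nuv) [] [e1 e2].
    by rewrite e2 eqxx.
  by rewrite e2 eqxx in nuv.
move=> e /andP [/edgesP [a [b [ab ->]]] /set2P [] ->].
  by case: pickP => [w /eqP //|/(_ b)]; rewrite eqxx.
by case: pickP => [w /eqP //|/(_ a)]; rewrite setUC eqxx.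
Qed.

Lemma card_edge : #|edge G| = nedges G.
Proof. by rewrite card_sig; apply: eq_card => e; rewrite inE. Qed.

Lemma sum_deg : \sum_(u : G) deg u = (nedges G).*2.
Proof.
transitivity (\sum_(u : G) \sum_(e : edge G | u \in val e) 1).
  apply: eq_bigr => u _; rewrite (sum_incident (fun=> 1)) sum1_card /deg.
  by apply: eq_card => v; rewrite inE.
rewrite (exchange_big_dep xpredT) //= -(muln2 (nedges G)) -card_edge.
rewrite -sum_nat_const; apply: eq_big => // -[e /= ee] _.
case/edgesP: (ee) => u [v [auv ->]].
transitivity #|[set u; v]|; last by rewrite cards2 (adj_neq auv).
by rewrite -sum1_card.
Qed.

(** Total on pairs of vertices, with 0 on non-edges, to avoid the subtype of edges. *)
Definition edge_label f u v : nat :=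
  oapp (fun e : edge G => f e : nat) 0 (insub [set u; v]).

Lemma edge_label_sym f u v : edge_label f u v = edge_label f v u.
Proof. by rewrite /edge_label setUC. Qed.

Lemma vsumE f u : vsum f u = \sum_(v | adj u v) edge_label f u v.
Proof.
rewrite -(sum_incident (fun e => oapp (fun e : edge G => f e : nat) 0 (insub e))).
by apply: eq_bigr => e _; rewrite valK.
Qed.

Lemma edge_label_gt0 f u v : is_labeling f -> adj u v -> 0 < edge_label f u v.
Proof.
move=> /andP [_ /eqP fim]; rewrite -mem_edges => auv.
rewrite /edge_label insubT /=; set e := Sub _ _.
by have := imset_f f (in_setT e); rewrite fim inE.
Qed.

Lemma edge_label_le f u v : edge_label f u v <= nedges G.
Proof. by rewrite /edge_label; case: insub => //= e; rewrite -ltnS. Qed.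

Lemma edge_label_inj f u v u' v' : is_labeling f -> adj u v -> adj u' v' ->
  edge_label f u v = edge_label f u' v' -> (u = u' /\ v = v') \/ (u = v' /\ v = u').
Proof.
move=> /andP [/injectiveP finj _] auv; have nuv := adj_neq auv; move: auv.
rewrite -!mem_edges => auv auv'; rewrite /edge_label !insubT /=.
by move/val_inj/finj/(congr1 val) => /= /(set2_inj nuv).
Qed.

(** Builds a labeling from vertex pairs: injectivity on q edges with values in 1..q makes it onto by
    cardinality. *)
Lemma labeling_of_sym (L : G -> G -> nat) :
    (forall u v, adj u v -> L u v = L v u) ->
    (forall u v, adj u v -> 0 < L u v <= nedges G) ->
    (forall u v u' v', adj u v -> adj u' v' -> L u v = L u' v' ->
       (u = u' /\ v = v') \/ (u = v' /\ v = u')) ->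
  exists2 f : edge_fun G, is_labeling f &
    forall u, vsum f u = \sum_(v | adj u v) L u v.
Proof.
move=> Lsym Lbnd Linj.
(* An arbitrary orientation of e is picked; symmetry of [L] makes the value independent of it. *)
pose F (e : {set G}) : nat :=
  if [pick p : G * G | adj p.1 p.2 && (e == [set p.1; p.2])] is Some p
  then L p.1 p.2 else 0.
have FE u v : adj u v -> F [set u; v] = L u v.
  move=> auv; rewrite /F; case: pickP => [[a b] /= /andP [_ /eqP]|/(_ (u, v))].
    by case/(set2_inj (adj_neq auv)) => [] [<- <-] //; rewrite (Lsym u v).
  by rewrite auv eqxx.
pose f : edge_fun G := [ffun e : edge G => inord (F (val e))].
have fE e : f e = F (val e) :> nat.
  case: e => e ee; rewrite ffunE /= inordK //.
  case/edgesP: (ee) => u [v [auv ->]].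
  by rewrite FE // ltnS; case/andP: (Lbnd _ _ auv).
have finj : injective f.
  move=> [e ee] [e' ee'] /(congr1 val) /=; rewrite !fE /= => eF.
  apply: val_inj => /=; move: eF.
  case/edgesP: ee => u [v [auv ->]]; case/edgesP: ee' => u' [v' [auv' ->]].
  by rewrite !FE // => /Linj [] // [-> ->] //; rewrite setUC.
exists f; last first.
  move=> u; rewrite /vsum (eq_bigr (fun e => F (val e))) => [|e _]; last exact: fE.
  by rewrite sum_incident; apply: eq_bigr => v; apply: FE.
apply/andP; split; first exact/injectiveP.
rewrite eqEcard; apply/andP; split.
  apply/subsetP => k /imsetP [[e ee] _ ->]; rewrite inE fE /=.
  by case/edgesP: ee => u [v [auv ->]]; rewrite FE //; case/andP: (Lbnd _ _ auv).
rewrite card_imset // cardsT card_edge.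
have -> : [set k : 'I_(nedges G).+1 | 0 < k] = [set~ ord0].
  by apply/setP => k; rewrite !inE lt0n.
by rewrite cardsC1 card_ord.
Qed.
End Edges.

(** * Chromatic numbers and color counts *)

Lemma bigmin_leq (I : finType) (P : pred I) (F : I -> nat) d i :
  P i -> \big[minn/d]_(j | P j) F j <= F i.
Proof.
move=> Pi; have := mem_index_enum i; elim: (index_enum I) => //= j s IHs.
rewrite inE big_cons => /orP [/eqP <-|/IHs le]; first by rewrite Pi geq_minl.
by case: ifP => // _; apply: leq_trans (geq_minr _ _) le.
Qed.

Lemma leq_bigmin (I : finType) (P : pred I) (F : I -> nat) d m :
  m <= d -> (forall i, P i -> m <= F i) -> m <= \big[minn/d]_(j | P j) F j.
Proof.
by move=> md mF; apply: (big_ind (leq m)) => // x y; rewrite leq_min => -> ->.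
Qed.

Lemma ncolors_le_card (G : sgraph) (f : edge_fun G) : ncolors f <= #|{: G}|.
Proof. by rewrite (leq_trans (size_undup _)) // size_map -cardE. Qed.

Lemma chi_la_le (G : sgraph) (f : edge_fun G) :
  local_antimagic f -> chi_la G <= ncolors f.
Proof. exact: bigmin_leq. Qed.

Lemma colorable_card (G : sgraph) : colorable G #|{: G}|.
Proof.
apply/existsP; exists [ffun u => enum_rank u].
apply/forallP => u; apply/forallP => v; apply/implyP => /adj_neq.
by rewrite !ffunE (inj_eq enum_rank_inj).
Qed.

Lemma chi_le (G : sgraph) k : k <= #|{: G}| -> colorable G k -> chi G <= k.
Proof.
move=> kG ck; have k_lt : k < #|{: G}|.+1 by [].
exact: (bigmin_leq (fun k : 'I__ => k : nat) _ (i := Ordinal k_lt)).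
Qed.

Lemma chi_le_ncolors (G : sgraph) (f : edge_fun G) :
  local_antimagic f -> chi G <= ncolors f.
Proof.
move=> /andP [_ /forallP fP]; apply: chi_le (ncolors_le_card f) _.
(* Colors are renumbered by their position in the list of distinct sums. *)
have lt u : index (vsum f u) (undup [seq vsum f u | u : G]) < ncolors f.
  by rewrite index_mem mem_undup; apply: image_f.
apply/existsP; exists [ffun u => Ordinal (lt u)].
apply/forallP => u; apply/forallP => v; apply/implyP => auv.
have /forallP /(_ v) := fP u; rewrite auv /=; apply: contraNneq.
rewrite !ffunE => /(congr1 val) /= eq_index; apply/eqP.
by apply: (index_inj 0) eq_index; rewrite mem_undup; apply: image_f.
Qed.

Lemma chi_le_chi_la (G : sgraph) : chi G <= chi_la G.
Proof.
apply: leq_bigmin => [|f]; last exact: chi_le_ncolors.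
by apply: leqW; apply: chi_le (colorable_card G).
Qed.

(** Colorings pull back along [h]; the size bound handles the default value in the minimum
    [chi H]. *)
Lemma chi_hom (G H : sgraph) (h : G -> H) :
  {homo h : u v / adj u v} -> #|{: G}| <= #|{: H}| -> chi G <= chi H.
Proof.
move=> hom leGH; apply: leq_bigmin => [|k ck].
  exact: leq_trans (chi_le (leqnn _) (colorable_card G)) leGH.
have [kG|/ltnW Gk] := leqP k #|{: G}|; last first.
  exact: leq_trans (chi_le (leqnn _) (colorable_card G)) Gk.
apply: chi_le kG _; case/existsP: ck => c /forallP cP.
apply/existsP; exists [ffun u => c (h u)].
apply/forallP => u; apply/forallP => v; apply/implyP => auv; rewrite !ffunE.
by have /forallP /(_ (h v)) /implyP := cP (h u); apply; apply: hom.
Qed.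

(** Sending each value of [k] to [h] at a chosen point above it reaches all values of [h]. Serves to
    compare the colors of G[O_n] with those of G through the projection. *)
Lemma size_undup_factor (T U : finType) (R S : eqType) (h : T -> R) (k : U -> S)
    (pi : T -> U) :
    (forall t t', k (pi t) = k (pi t') -> h t = h t') ->
  size (undup [seq h t | t : T]) <= size (undup [seq k u | u : U]).
Proof.
move=> hk; pose  sel c := [pick t | k (pi t) == c].
rewrite -(size_map Some) -(size_map (fun c => omap h (sel c)) (undup [seq k u | u : U])).
apply: uniq_leq_size.
  by rewrite map_inj_uniq ?undup_uniq // => x y [].
move=> _ /mapP [c + ->]; rewrite mem_undup => /imageP [t _ ->].
apply/mapP; exists (k (pi t)); first by rewrite mem_undup; apply: image_f.
rewrite /sel; case: pickP => [t' /eqP /hk /= -> //|/(_ t)].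
by rewrite eqxx.
Qed.

(** * The labeling of G[O_n] *)

Section Blowup.
Variables (G : sgraph) (n : nat).
Notation blowup := (lex_product G (null_graph n)).

Lemma adj_blowup (p q : blowup) : adj p q = adj p.1 q.1.
Proof. by rewrite /= /lex_adj andbF orbF. Qed.

(** By the handshake identity: each of the n copies of u has degree n deg(u). *)
Lemma nedges_blowup : nedges blowup = nedges G * n ^ 2.
Proof.
apply: double_inj; rewrite -sum_deg doubleMl -sum_deg -mulnn mulnA.
transitivity (\sum_(p : G * 'I_n) deg p.1 * n).
  apply: eq_bigr => p _; have := cardsX [set v | adj p.1 v] [set: 'I_n].
  rewrite cardsT card_ord => <-.
  by apply: eq_card => q; rewrite !inE andbT [LHS]adj_blowup.
rewrite -(pair_bigA _ (fun u _ => deg u * n)) /= !big_distrl /=.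
by apply: eq_bigr => u _; rewrite sum_nat_const card_ord mulnC.
Qed.

(* The edge {u, v} is oriented by enum_rank, as A need not be symmetric. *)
Definition blowup_label (f : edge_fun G) (A : 'I_n -> 'I_n -> nat) (p q : blowup) :=
  (edge_label f p.1 q.1).-1 * n ^ 2 +
  (if enum_rank p.1 < enum_rank q.1 then A p.2 q.2 else A q.2 p.2).+1.

(** An edge e at u adds n^3 (f(e) - 1) + n(n^2 - 1)/2 + n = n^3 f(e) - (n^3 - n)/2 to the sum at (u,
    i). The identity is doubled and rearranged to stay in [nat]. *)
Lemma blowup_labeling (f : edge_fun G) : is_labeling f -> 3 <= n ->
  exists2 g : edge_fun blowup, is_labeling g &
    forall p : blowup,
      (vsum g p).*2 + deg p.1 * (n ^ 3 - n) = (n ^ 3 * vsum f p.1).*2.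
Proof.
move=> fl n3; have [A [ltA injA rowA colA]] := semi_magic_exists n3.
rewrite card_ord in ltA rowA colA.
have n2_gt0 : 0 < n ^ 2 by rewrite expn_gt0; case: n n3.
pose B (p q : blowup) := if enum_rank p.1 < enum_rank q.1 then A p.2 q.2 else A q.2 p.2.
have ltB p q : B p q < n ^ 2 by rewrite /B; case: ifP.
have [||p q p' q'|g gl gsum] := @labeling_of_sym blowup (blowup_label f A).
- move=> p q; rewrite adj_blowup => /adj_neq neq.
  rewrite /blowup_label edge_label_sym; congr (_ + _.+1).
  case: ltngtP => // /val_inj /enum_rank_inj e.
  by rewrite e eqxx in neq.
- move=> p q; rewrite adj_blowup => apq; rewrite nedges_blowup.
  have := edge_label_le f p.1 q.1; have := edge_label_gt0 fl apq.
  have := ltB p q; rewrite /blowup_label -/(B p q).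
  move: (edge_label _ _ _) (nedges G) (B p q) => [//|k] l b ltb _ ltk.
  rewrite addnS ltnS leq0n /=; apply: leq_trans (_ : k.+1 * n ^ 2 <= _).
    by rewrite mulSn addnC -addSn leq_add2r.
  by rewrite leq_mul2r ltk orbT.
- rewrite !adj_blowup => apq apq'; rewrite /blowup_label -/(B p q) -/(B p' q').
  rewrite !addnS => -[e].
  (* The residue mod n^2 is the entry of the square; the quotient then gives the edge of G. *)
  have eB : B p q = B p' q'.
    by have := congr1 (modn^~ (n ^ 2)) e; rewrite !modnMDl !modn_small.
  move: e; rewrite eB => /addIn /eqP; rewrite eqn_pmul2r // => /eqP e.
  have := edge_label_gt0 fl apq; have := edge_label_gt0 fl apq' => gt0' gt0.
  have {}e : edge_label f p.1 q.1 = edge_label f p'.1 q'.1.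
    by rewrite -(prednK gt0) e prednK.
  have := edge_label_inj fl apq apq' e.
  have := adj_neq apq'; move: eB; rewrite /B.
  case: p p' q q' {apq apq' e gt0 gt0'} => [u i] [u' i'] [v j] [v' j'] /= eB neq.
  (* If the edge of G is met in the opposite direction, the ranks are swapped too, so the cells
     agree crosswise. *)
  case=> -[eu ev]; subst.
    by case: ifP eB => _ /injA [-> ->]; left.
  by move: eB; case: ltngtP => [_|_|/val_inj /enum_rank_inj e];
    [move=> /injA [-> ->]; right | move=> /injA [-> ->]; right | rewrite e eqxx in neq].
exists g => // -[u i]; rewrite gsum /= vsumE.
have -> : \sum_(q : blowup | adj ((u, i) : blowup) q) blowup_label f A (u, i) q =
    \sum_(v | adj u v) \sum_(j < n) blowup_label f A (u, i) (v, j).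
  rewrite pair_big /=; apply: eq_big => [q|[v j] _] //.
  by rewrite andbT [lex_adj _ _]adj_blowup.
rewrite /deg -sum1dep_card big_distrl big_distrr /= -!mul2n !big_distrr -big_split /=.
apply: eq_bigr => v auv; rewrite /blowup_label big_split /= sum_nat_const card_ord.
under eq_bigr do rewrite -addn1.
rewrite big_split /= sum_nat_const card_ord.
(* The orientation decides between a row and a column of [A]; both have the same sum. *)
have -> : \sum_(j < n) (if enum_rank u < enum_rank v then A i j else A j i) =
          (n * (n ^ 2).-1)./2.
  by case: (_ < enum_rank v); [rewrite -(rowA i) | rewrite -(colA i)]; rewrite doubleK.
have := edge_label_gt0 fl auv; case: (edge_label f u v) => // k _ /=.
have od : (n * (n ^ 2).-1)./2.*2 = n * (n ^ 2).-1 by rewrite -(rowA i) doubleK.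
move: od n2_gt0; rewrite (expnSr n 2); set h := _./2.
by case: (n ^ 2) => // N; rewrite -muln2 => od _; nia.
Qed.

Lemma lifted_colorE (f : edge_fun G) (u : G) (c : nat) : 0 < n ->
  c.*2 + deg u * (n ^ 3 - n) = (n ^ 3 * vsum f u).*2 ->
  lifted_color f n u = (c%:R)%R.
Proof.
move=> n0 /(congr1 (fun k => k%:R : rat)%R).
have le : n <= n ^ 3 by rewrite -{1}(expn1 n) leq_pexp2l.
rewrite -!mul2n natrD !natrM natrB // natrX => e; rewrite /lifted_color.
have -> : (c%:R = (2 * c%:R) / 2 :> rat)%R by field.
have -> : (2 * c%:R =
    2 * (n%:R ^+ 3 * (vsum f u)%:R) - (deg u)%:R * (n%:R ^+ 3 - n%:R) :> rat)%R.
  by rewrite -e addrK.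
by field.
Qed.
End Blowup.

(** * Lower bound for balanced bipartite graphs *)

Lemma connected_neighbor (G : sgraph) (u : G) :
  connected G -> 1 < #|{: G}| -> exists v, adj u v.
Proof.
move=> /andP [_ /forallP conn] G2.
have [w nuw] : exists w, w != u.
  have : 0 < #|[set~ u]| by rewrite cardsC1; case: #|_| G2 => [|[]].
  by case/card_gt0P => w; rewrite !inE; exists w.
have /forallP /(_ w) /connectP [[|v p] /= pth e] := conn u.
  by rewrite e eqxx in nuw.
by case/andP: pth; exists v.
Qed.

(** Both colorings change across an edge, so their exclusive or is constant along paths. *)
Lemma two_coloring_unique (G : sgraph) (c d : G -> bool) : connected G ->
  (forall u v, adj u v -> c u != c v) -> (forall u v, adj u v -> d u != d v) ->
  exists b, forall u, c u = d u (+) b.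
Proof.
move=> /andP [/card_gt0P [u0 _] /forallP conn] cP dP.
exists (c u0 (+) d u0) => u.
have /forallP /(_ u) /connectP [p pth ->] := conn u0.
elim: p u0 pth => [|v p IHp] u0 /=; first by rewrite addbC addbK.
case/andP=> auv /IHp ->; move: (cP _ _ auv) (dP _ _ auv).
by case: (c u0) (c v) (d u0) (d v) => [] [] [] [].
Qed.

(** Every edge has one end on each side, so either sum counts each label once. *)
Lemma sum_vsum_bipartite (G : sgraph) (f : edge_fun G) (A : {set G}) :
  (forall u v : G, adj u v -> (u \in A) != (v \in A)) ->
  \sum_(u in A) vsum f u = \sum_(u in ~: A) vsum f u.
Proof.
move=> bip; under eq_bigr do rewrite vsumE.
under [RHS]eq_bigr do rewrite vsumE.
rewrite (exchange_big_dep (mem (~: A))) /= => [|u v uA /bip]; last first.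
  by rewrite uA inE.
apply: eq_bigr => v; rewrite inE => vA; apply: eq_big => [u|u _].
  rewrite adj_sym andbC; case auv: (adj v u) => //=.
  by have := bip _ _ auv; rewrite (negbTE vA); case: (u \in A).
exact: edge_label_sym.
Qed.

(** Turns a coloring with at most two colors into a Boolean one, the test against the first
    color. *)
Lemma ncolors_le2 (G : sgraph) (f : edge_fun G) : ncolors f <= 2 ->
  exists x, forall u v, (vsum f u == x) = (vsum f v == x) -> vsum f u = vsum f v.
Proof.
rewrite /ncolors; set s := undup _ => s2.
have mems u : vsum f u \in s by rewrite mem_undup; apply: image_f.
exists (head 0 s) => u v; move: (mems u) (mems v); move: s s2 {mems}.
case=> [|x [|y [|]]] //= _; rewrite !inE.
  by move=> /eqP -> /eqP ->.
by case: eqP => [-> _|_ /eqP ->]; case: eqP => // _ /eqP ->.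
Qed.

Lemma balanced_blowup_colors (G : sgraph) n
    (g : edge_fun (lex_product G (null_graph n))) :
  connected G -> 1 < #|{: G}| -> 0 < n -> balanced_bipartite G ->
  local_antimagic g -> 2 < ncolors g.
Proof.
move=> conn G2 n0 [A [bip cardA]] /andP [_ /forallP gP]; rewrite ltnNge.
have {}gP p q : adj p.1 q.1 -> vsum g p != vsum g q.
  rewrite -(@adj_blowup G n) => apq.
  by have /forallP /(_ q) := gP p; rewrite apq.
apply/negP => /ncolors_le2 [x xP].
have cP p q : adj p.1 q.1 -> (vsum g p == x) != (vsum g q == x).
  by move=> /gP; apply: contraNneq => /xP ->.
pose i0 : 'I_n := Ordinal n0.
(* Uniqueness is applied on the slice [i0], a copy of G. *)
have [b bP] := two_coloring_unique conn (fun u v => cP (u, i0) (v, i0)) bip.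
have {}bP p : (vsum g p == x) = (p.1 \in A) (+) b.
  (* [p] and [(p.1, i0)] share the neighbor [(v, i0)], so the test agrees on them. *)
  have [v auv] := connected_neighbor p.1 conn G2.
  rewrite -bP; have := cP p (v, i0) auv; have := cP (p.1, i0) (v, i0) auv.
  by do 3!case: (_ == x).
have [u0 u0A] : exists u, u \in A.
  apply/card_gt0P; rewrite -(double_gt0 #|A|) -addnn {2}cardA cardsC.
  exact: ltnW.
have [v auv] := connected_neighbor u0 conn G2.
have v0A : v \notin A by have := bip _ _ auv; rewrite u0A; case: (v \in A).
have /eqP := gP (u0, i0) (v, i0) auv; apply.
pose A' : {set lex_product G (null_graph n)} := setX A [set: 'I_n].
have A'E p : (p \in A') = (p.1 \in A) by rewrite !inE andbT.
have cardA' : #|A'| = #|~: A'|.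
  have -> : ~: A' = setX (~: A) [set: 'I_n] by apply/setP => p; rewrite !inE !andbT.
  by rewrite !cardsX cardA.
have e : \sum_(p in A') vsum g p = \sum_(p in ~: A') vsum g p.
  by apply: sum_vsum_bipartite => p q; rewrite !A'E adj_blowup; apply: bip.
rewrite (eq_bigr (fun=> vsum g (u0, i0))) in e; last first.
  by move=> p; rewrite A'E => pA; apply: xP; rewrite !bP pA u0A.
rewrite [RHS](eq_bigr (fun=> vsum g (v, i0))) in e; last first.
  by move=> p; rewrite inE A'E => pA; apply: xP; rewrite !bP (negbTE pA) (negbTE v0A).
apply/eqP; rewrite -(@eqn_pmul2l #|A'|); last first.
  by apply/card_gt0P; exists (u0, i0); rewrite A'E.
by rewrite {2}cardA' -!sum_nat_const e.
Qed.

(** * Upper bound and the two equality cases *)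

Theorem theorem2p1 (G : sgraph) (f : edge_fun G) (n : nat)
    (G_conn : connected G)
    (f_la : local_antimagic f)
    (f_min : ncolors f = chi_la G)
    (n_ge3 : 3 <= n)
    (same_deg : forall u v : G, vsum f u = vsum f v -> deg u = deg v)
    (lift_neq : forall u v : G, vsum f u <> vsum f v ->
       lifted_color f n u <> lifted_color f n v) :
  (exists g : edge_fun (lex_product G (null_graph n)), local_antimagic g) /\
  chi (lex_product G (null_graph n)) <= chi_la (lex_product G (null_graph n)) /\
  chi_la (lex_product G (null_graph n)) <= chi_la G /\
  (chi G = chi_la G \/ (balanced_bipartite G /\ chi_la G = 3) ->
   chi_la (lex_product G (null_graph n)) = chi_la G).
Proof.
have /andP [f_lab /forallP f_neq] := f_la.
have n_gt0 : 0 < n by case: n n_ge3 {lift_neq}.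
have [g g_lab gE] := blowup_labeling f_lab n_ge3.
have g_lift p := lifted_colorE n_gt0 (gE p).
have g_la : local_antimagic g.
  apply/andP; split=> //; apply/forallP => p; apply/forallP => q; apply/implyP.
  rewrite adj_blowup => apq; have /forallP /(_ q.1) := f_neq p.1; rewrite apq /=.
  by move=> /eqP /lift_neq; rewrite !g_lift; apply: contra_not_neq => ->.
have le_la : chi_la (lex_product G (null_graph n)) <= chi_la G.
  apply: leq_trans (chi_la_le g_la) _; rewrite -f_min.
  (* By (i), the color of u under f fixes deg(u), hence the sums at all copies of u. *)
  apply: (@size_undup_factor _ _ _ _ _ _ (fun p : G * 'I_n => p.1)) => p q e.
  apply: double_inj; apply/eqP.
  by rewrite -(eqn_add2r (deg p.1 * (n ^ 3 - n))) {2}(same_deg _ _ e) !gE e.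
split; first by exists g.
split; first exact: chi_le_chi_la.
split=> // cases; apply/eqP; rewrite eqn_leq le_la /=.
have i0 : 'I_n := Ordinal n_gt0.
case: cases => [<-|[bal la3]].
  apply: leq_trans (chi_le_chi_la _).
  (* The slice [i0] embeds G. *)
  apply: (@chi_hom _ _ (fun u => (u, i0) : lex_product G (null_graph n))).
    by move=> u v; rewrite adj_blowup.
  by rewrite card_prod card_ord leq_pmulr.
have G3 : 2 < #|{: G}| by rewrite -la3 -f_min ncolors_le_card.
have la_ge3 (h : edge_fun (lex_product G (null_graph n))) :
    local_antimagic h -> 2 < ncolors h.
  exact: balanced_blowup_colors G_conn (ltnW G3) n_gt0 bal.
rewrite la3; apply: leq_bigmin => //.
(* The default value of the minimum must also be at least 3; the colors of [g] force enough
   vertices. *)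
exact: leqW (leq_trans (la_ge3 _ g_la) (ncolors_le_card g)).
Qed.
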